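(* Let $m,n\ge1$ and let $c=(c_{00},c_1,\dots,c_{m-1})\in\mathbb C^m$ be arbitrary. Define $\lambda_0,\dots,\lambda_{m-1}$ and $\kappa_0,\dots,\kappa_{m-1}$ by $$\lambda_0=-mc_{00}+\sum_{l=1}^{m-1}c_l,\qquad \lambda_i=\sum_{l=1}^{m-1}c_l\mu^{-il}\ (i\neq0),$$ $$\sum_{r=1}^{m-1}c_rs^r=\sum_{l=0}^{m-1}m(\kappa_l-\kappa_{l-1})\epsilon_l,\qquad \kappa_{m-1}=\sum_{r=1}^{m-1}\frac{m-r}{m^2}\lambda_r .$$ Let $Y_i$ ($i=0,\dots,m-1$) be the $n\times n$ matrices, depending on $\nu=(\nu_1,\dots,\nu_n)\in\mathfrak h_{\mathrm{reg}}$ and $\mu=(\mu_1,\dots,\mu_n)\in\mathfrak h^*$, with entries $$(Y_i)_{jj}=\mu_j+\frac1{\nu_j}\Big(a+\sum_{r=0}^i\lambda_r\Big),\quad a=-\sum_{r=0}^{m-1}\frac{m-r}m\lambda_r,\qquad (Y_i)_{jk}=|\lambda|\frac{\nu_j^i\nu_k^{m-i-1}}{\nu_j^m-\nu_k^m}\ (j\neq k),$$ and let $Y=Y(\nu,\mu)=\sum_iY_i\in\mathrm{End}(\bigoplus_{i}V_i)$ be the $mn\times mn$ matrix in which $Y_i$ acts from $V_{i+1}=\mathbb C^n$ to $V_i=\mathbb C^n$ ($i\in\mathbb Z/m\mathbb Z$). Then for every $j\in\mathbb N$ $$\frac1m\,\mathrm{tr}\big(Y^{jm}\big)=L_j(\nu,\mu),$$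 where $L_j=L_j(x,p)$ are the Hamiltonians of the Calogero--Moser problem for $G=\mathbb Z_m\wr S_n$.
   Context: Here $\mu$ without index (in powers $\mu^{-il}$, $\mu^r$) denotes a fixed primitive $m$-th root of unity, while $\mu_1,\dots,\mu_n$ are complex coordinates; $|\lambda|=\sum_{i=0}^{m-1}\lambda_i$; indices of $\lambda,\kappa,\epsilon$ are mod $m$. $\Gamma=\{e,s,\dots,s^{m-1}\}$ is the cyclic group and $\epsilon_l=\frac1m\sum_{r=0}^{m-1}\mu^{-lr}s^r\in\mathbb C\Gamma$. $G=S_n\ltimes\Gamma^n$ acts on $\mathfrak h=\mathbb C^n$: $S_n$ permutes coordinates, and $s_i$ (the generator $s$ in the $i$-th factor) multiplies the $i$-th coordinate by $\mu$. $s_{ij}$ denotes the transposition. $\mathfrak h_{\mathrm{reg}}=\{x\in\mathfrak h:\prod_ix_i\prod_{i<j}(x_i^m-x_j^m)\neq0\}$. Let $(x_1,\dots,x_n,p_1,\dots,p_n)$ be the standard coordinates on $\mathfrak h\times\mathfrak h^*$; $G$ acts on the (commutative) algebra $\mathbb C[\mathfrak h_{\mathrm{reg}}\times\mathfrak h^*]$, so that $s_i(x_i)=\mu^{-1}x_i$, $s_i(p_i)=\mu p_i$, and $S_n$ permutes the $x_i$ and the $p_i$. $\mathbb C[\mathfrak h_{\mathrm{reg}}\times\mathfrak h^*]*G$ is the crossed product ($gf=g(f)g$). The classical Dunkl operators are the elements of $\mathbb C[\mathfrak h_{\mathrm{reg}}\times\mathfrak h^*]*G$ $$D_i=p_i-c_{00}\sum_{j\neq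 i}\sum_{r=0}^{m-1}\frac1{x_i-\mu^rx_j}s_i^rs_{ij}s_i^{-r}-\frac1{x_i}\sum_{l=0}^{m-1}m\kappa_l(\epsilon_l)_i,\qquad(\epsilon_l)_i=\frac1m\sum_{r=0}^{m-1}\mu^{-lr}s_i^r .$$ Let $\mathbf e=\frac1{|G|}\sum_{g\in G}g$, and let $\mathbf m:\mathbb C[\mathfrak h_{\mathrm{reg}}\times\mathfrak h^*]*G\to\mathbb C[\mathfrak h_{\mathrm{reg}}\times\mathfrak h^*]$ be the linear map $\sum_gB_g\,g\mapsto\sum_gB_g$. The Calogero--Moser Hamiltonians are $L_j(x,p)=\mathbf m\big(\mathbf e(D_1^{jm}+\dots+D_n^{jm})\mathbf e\big)$. *)

(* Defs.v *)
From HB Require Import structures.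
From mathcomp Require Import all_boot all_order all_fingroup all_algebra.
From mathcomp Require Import boolp functions reals.
From mathcomp Require Import complex.

Set Implicit Arguments.
Unset Strict Implicit.
Unset Printing Implicit Defensive.

Import Order.TTheory GRing.Theory Num.Theory.

Local Open Scope ring_scope.

(* Crossed products A * G, for a finite group G acting on A by ring
   automorphisms; an element is the family of its coefficients (B_g)_g. *)

Record ring_action (gT : finGroupType) (A : pzRingType) := RingAction {
  ract :> gT -> {rmorphism A -> A};
  ract_1 : forall a, ract 1%g a = a;
  ract_M : forall g h a, ract (g * h)%g a = ract g (ract h a) }.

Definition crossed (gT : finGroupType) (A : pzRingType)
  (to : ring_action gT A) : Type := {ffun gT -> A}.

Section Crossed.
Variables (gT : finGroupType) (A : pzRingType) (to : ring_action gT A).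
Local Notation X := (crossed to).

HB.instance Definition _ := GRing.Zmodule.copy X {ffun gT -> A}.

Definition grp_elt (g : gT) : X := [ffun h => (h == g)%:R].

(* (\sum_h a_h h) (\sum_k b_k k) = \sum_(h, k) a_h h(b_k) hk *)
Definition crossed_mul (a b : X) : X :=
  [ffun g => \sum_(h : gT) a h * to h (b (h^-1 * g)%g)].

Fact crossed_mulA : associative crossed_mul.
Proof.
move=> a b c; apply/ffunP=> g; rewrite !ffunE.
transitivity (\sum_h \sum_k
  a h * (to h (b (h^-1 * k)%g) * to k (c (k^-1 * g)%g))).
  apply: eq_bigr => h _; rewrite ffunE raddf_sum mulr_sumr.
  rewrite (reindex_inj (mulgI h^-1)%g) /=; apply: eq_bigr => k _.
  by rewrite rmorphM -ract_M mulKVg invMg invgK -!mulgA mulKVg.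
rewrite exchange_big; apply: eq_bigr => k _ /=.
by rewrite ffunE mulr_suml; apply: eq_bigr => h _; rewrite mulrA.
Qed.

Fact crossed_mul1 : left_id (grp_elt 1) crossed_mul.
Proof.
move=> a; apply/ffunP=> g; rewrite ffunE (bigD1 1%g) //= big1.
  by rewrite ffunE eqxx mul1r ract_1 invg1 mul1g addr0.
by move=> h h1; rewrite ffunE (negPf h1) mul0r.
Qed.

Fact crossed_1mul : right_id (grp_elt 1) crossed_mul.
Proof.
move=> a; apply/ffunP=> g; rewrite ffunE (bigD1 g) //= big1.
  by rewrite ffunE mulVg eqxx rmorph1 mulr1 addr0.
move=> h hg; rewrite ffunE -eq_invg_mul invgK (negPf hg).
by rewrite rmorph0 mulr0.
Qed.

Fact crossed_mulDl : left_distributive crossed_mul +%R.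
Proof.
move=> a b c; apply/ffunP=> g; rewrite !ffunE -big_split.
by apply: eq_bigr => h _; rewrite ffunE mulrDl.
Qed.

Fact crossed_mulDr : right_distributive crossed_mul +%R.
Proof.
move=> a b c; apply/ffunP=> g; rewrite !ffunE -big_split.
by apply: eq_bigr => h _; rewrite ffunE rmorphD mulrDr.
Qed.

HB.instance Definition _ := GRing.Zmodule_isPzRing.Build X
  crossed_mulA crossed_mul1 crossed_1mul crossed_mulDl crossed_mulDr.

Definition crossed_scale (a : A) (b : X) : X := [ffun g => a * b g].

Fact crossed_scaleA a b (x : X) :
  crossed_scale a (crossed_scale b x) = crossed_scale (a * b) x.
Proof. by apply/ffunP=> g; rewrite !ffunE mulrA. Qed.
Fact crossed_scale1 : left_id 1 crossed_scale.
Proof. by move=> x; apply/ffunP=> g; rewrite !ffunE mul1r. Qed.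
Fact crossed_scaleDr : right_distributive crossed_scale +%R.
Proof. by move=> a x y; apply/ffunP=> g; rewrite !ffunE mulrDr. Qed.
Fact crossed_scaleDl (x : X) :
  {morph crossed_scale^~ x : a b / a + b}.
Proof. by move=> a b; apply/ffunP=> g; rewrite !ffunE mulrDl. Qed.

HB.instance Definition _ := GRing.Zmodule_isLmodule.Build A X
  crossed_scaleA crossed_scale1 crossed_scaleDr crossed_scaleDl.

Definition crossed_sum (b : X) : A := \sum_(g : gT) b g.

End Crossed.

Notation "[ 'gr' to : g ]" := (grp_elt to g)
  (at level 0, to at level 99, g at level 99, format "[ 'gr'  to  :  g ]").

(* The relation g f = g(f) g in A * G. *)
Lemma crossed_relE (gT : finGroupType) (A : pzRingType)
    (to : ring_action gT A) (g : gT) (f : A) :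
  [gr to : g] * (f *: (1 : crossed to)) = to g f *: [gr to : g].
Proof.
apply/ffunP=> h; rewrite ffunE (bigD1 g) //= big1 => [|k kg]; last first.
  by rewrite ffunE (negPf kg) mul0r.
rewrite !ffunE eqxx mul1r addr0 rmorphM -eq_mulVg1 (eq_sym g).
by case: (h == g); rewrite ?rmorph1 ?rmorph0.
Qed.

Lemma grp_eltM (gT : finGroupType) (A : pzRingType)
    (to : ring_action gT A) (g h : gT) :
  [gr to : g] * [gr to : h] = [gr to : g * h].
Proof.
apply/ffunP=> k; rewrite ffunE (bigD1 g) //= big1 => [|l lg]; last first.
  by rewrite ffunE (negPf lg) mul0r.
rewrite !ffunE eqxx mul1r addr0 -(inj_eq (mulgI g)) mulKVg.
by case: (k == _); rewrite ?rmorph1 ?rmorph0.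
Qed.

(* With the trivial action, the crossed product is the group algebra. *)
Definition trivial_action (gT : finGroupType) (A : pzRingType) :
  ring_action gT A :=
  @RingAction gT A (fun=> idfun) (fun=> erefl) (fun _ _ _ => erefl).

Notation group_algebra A gT := (crossed (trivial_action gT A)).

(* The wreath product S_n |x Gamma^n, where Gamma is the additive group
   'I_m'.+1 = Z/m, m = m'.+1.  Wreath sigma gam stands for gam * sigma:
   sigma permutes the coordinates first, then the i-th one is rotated by
   gam i.  Permutations compose as functions, whereas (s * t)%g is t \o s on
   'S_n: hence the swap in wreath_mul. *)

Record wreath (m' n : nat) := Wreath {
  wperm : 'S_n;
  wrot : {ffun 'I_n -> 'I_m'.+1} }.

Section Wreath.
Variables m' n : nat.
Local Notation G := (wreath m' n).
Implicit Types g h : G.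

Definition wreath_pair g := (wperm g, wrot g).
Definition pair_wreath u : G := Wreath u.1 u.2.
Fact wreath_pairK : cancel wreath_pair pair_wreath. Proof. by case. Qed.

HB.instance Definition _ := Finite.copy G (can_type wreath_pairK).

Definition wreath_one : G := Wreath 1 [ffun => 1%g].

Definition wreath_mul g h : G :=
  Wreath (wperm h * wperm g)
         [ffun i => (wrot g i * wrot h ((wperm g)^-1%g i))%g].

Definition wreath_inv g : G :=
  Wreath (wperm g)^-1 [ffun i => ((wrot g (wperm g i))^-1)%g].

Lemma wreathP g h : wperm g = wperm h -> wrot g =1 wrot h -> g = h.
Proof.
by case: g h => [s a] [t b] /= -> ab; congr Wreath; apply/ffunP.
Qed.

Fact wreath_mulA : associative wreath_mul.
Proof.
move=> g h k; apply: wreathP => /= [|i]; first by rewrite mulgA.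
by rewrite !ffunE mulgA invMg permM.
Qed.

Fact wreath_mul1 : left_id wreath_one wreath_mul.
Proof.
move=> g; apply: wreathP => /= [|i]; first by rewrite mulg1.
by rewrite !ffunE mul1g invg1 perm1.
Qed.

Fact wreath_mulV : left_inverse wreath_one wreath_inv wreath_mul.
Proof.
move=> g; apply: wreathP => /= [|i]; first by rewrite mulgV.
by rewrite !ffunE invgK mulVg.
Qed.

HB.instance Definition _ :=
  Finite_isGroup.Build G wreath_mulA wreath_mul1 wreath_mulV.

(* [Zp1] is the generator s of Gamma (trivial when m = 1). *)
Definition wgen (i : 'I_n) : G :=
  Wreath 1 [ffun k => if k == i then Zp1 else 1%g].

Definition wtransp (i j : 'I_n) : G := Wreath (tperm i j) [ffun => 1%g].

End Wreath.

Section Hreg.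
Variables (C : numClosedFieldType) (m' n : nat).
Local Notation m := m'.+1.

Definition disc (x : 'rV[C]_n) : C :=
  (\prod_i x 0 i) *
  \prod_(i < n) \prod_(j < n | (i < j)%N) (x 0 i ^+ m - x 0 j ^+ m).

Record hreg := Hreg { hreg_val :> 'rV[C]_n; hregP : disc hreg_val != 0 }.

Definition phase : Type := hreg * 'rV[C]_n.

(* The coordinate ring of the affine variety hreg x h^* : the C-algebra of
   functions generated by the coordinates and by 1 / disc. *)
Inductive regular : (phase -> C) -> Prop :=
| regular_cst (k : C) : regular (fun=> k)
| regular_x (i : 'I_n) : regular (fun v => (v.1 : 'rV[C]_n) 0 i)
| regular_p (i : 'I_n) : regular (fun v => v.2 0 i)
| regular_Vdisc : regular (fun v => (disc v.1)^-1)
| regularD f g : regular f -> regular g -> regular (fun v => f v + g v)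
| regularM f g : regular f -> regular g -> regular (fun v => f v * g v).

Definition is_regular : {pred phase -> C} := fun f => `[< regular f >].

Fact is_regular_subring : subring_closed is_regular.
Proof.
split=> [|f g /asboolP rf /asboolP rg|f g /asboolP rf /asboolP rg];
  apply/asboolP.
- exact: (regular_cst 1).
- have -> : f - g = (fun v => f v + (fun v => (-1) * g v) v).
    by apply: funext => v; rewrite mulN1r.
  by apply: regularD => //; apply: (regularM (regular_cst (-1))).
- exact: regularM.
Qed.

HB.instance Definition _ :=
  GRing.isSubringClosed.Build (phase -> C) is_regular is_regular_subring.

Record regfun := RegFun {
  regfun_val :> phase -> C;
  regfunP : regfun_val \in is_regular }.

HB.instance Definition _ := [isSub for regfun_val].
HB.instance Definition _ := [Choice of regfun by <:].
HB.instance Definition _ :=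
  GRing.SubChoice_isSubComPzRing.Build (phase -> C) is_regular regfun
    is_regular_subring.

Definition mk_regfun f (rf : regular f) : regfun := RegFun (asboolT rf).

Definition cst_fun (k : C) : regfun := mk_regfun (regular_cst k).
Definition x_fun (i : 'I_n) : regfun := mk_regfun (regular_x i).
Definition p_fun (i : 'I_n) : regfun := mk_regfun (regular_p i).

Lemma eq_regular (f g : phase -> C) : regular f -> f =1 g -> regular g.
Proof. by move=> rf /funext <-. Qed.

Lemma regularX f k : regular f -> regular (fun v => f v ^+ k).
Proof.
move=> rf; elim: k => [|k IHk].
  have -> : (fun v => f v ^+ 0) = (fun=> 1) by apply: funext.
  exact: regular_cst.
have -> : (fun v => f v ^+ k.+1) = (fun v => f v * (fun v => f v ^+ k) v).
  by apply: funext => v; rewrite exprS.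
exact: regularM.
Qed.

Lemma regularB f g : regular f -> regular g -> regular (fun v => f v - g v).
Proof.
move=> rf rg; have -> : (fun v => f v - g v) = (fun v => f v + (fun v => (-1) * g v) v).
  by apply: funext => v; rewrite mulN1r.
by apply: regularD => //; apply: (regularM (regular_cst (-1))).
Qed.

Lemma regular_prod (I : Type) (r : seq I) (P : pred I) (F : I -> phase -> C) :
  (forall i, P i -> regular (F i)) ->
  regular (fun v => \prod_(i <- r | P i) F i v).
Proof.
move=> rF; elim: r => [|i r IHr].
  have -> : (fun v => \prod_(i <- [::] | P i) F i v) = (fun=> 1).
    by apply: funext => v; rewrite big_nil.
  exact: regular_cst.
case Pi : (P i); last first.
  congr regular: IHr; apply: funext => v.
  by rewrite big_cons Pi.
have -> : (fun v => \prod_(i <- i :: r | P i) F i v) =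
    (fun v => F i v * (fun v => \prod_(i <- r | P i) F i v) v).
  by apply: funext => v; rewrite big_cons Pi.
by apply: regularM => //; apply: rF.
Qed.

Lemma regular_sum (I : Type) (r : seq I) (P : pred I) (F : I -> phase -> C) :
  (forall i, P i -> regular (F i)) ->
  regular (fun v => \sum_(i <- r | P i) F i v).
Proof.
move=> rF; elim: r => [|i r IHr].
  have -> : (fun v => \sum_(i <- [::] | P i) F i v) = (fun=> 0).
    by apply: funext => v; rewrite big_nil.
  exact: regular_cst.
case Pi : (P i); last first.
  congr regular: IHr; apply: funext => v.
  by rewrite big_cons Pi.
have -> : (fun v => \sum_(i <- i :: r | P i) F i v) =
    (fun v => F i v + (fun v => \sum_(i <- r | P i) F i v) v).
  by apply: funext => v; rewrite big_cons Pi.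
by apply: regularD => //; apply: rF.
Qed.

Lemma regularV_dvd (f g : phase -> C) : regular g ->
  (forall v : phase, disc v.1 = f v * g v) -> regular (fun v => (f v)^-1).
Proof.
move=> rg fg; have -> : (fun v => (f v)^-1) = (fun v => g v * (disc v.1)^-1).
  apply: funext => v; have := hregP v.1; rewrite fg mulf_eq0 negb_or.
  by case/andP=> _ g0; rewrite invfM mulrCA mulfV ?mulr1.
by apply: (regularM rg); apply: regular_Vdisc.
Qed.

Lemma regularVx i : regular (fun v => ((v.1 : 'rV[C]_n) 0 i)^-1).
Proof.
pose F (v : phase) := (\prod_(k | k != i) (v.1 : 'rV[C]_n) 0 k) *
  (\prod_(i < n) \prod_(j < n | (i < j)%N)
     ((v.1 : 'rV[C]_n) 0 i ^+ m - (v.1 : 'rV[C]_n) 0 j ^+ m)).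
apply: (@regularV_dvd _ F).
  apply: regularM; apply: regular_prod => k _; first exact: regular_x.
  apply: regular_prod => l _.
  by apply: regularB; apply: regularX; apply: regular_x.
by move=> v; rewrite /disc (bigD1 i) //= -mulrA.
Qed.

Lemma regularVxm i j : i != j ->
  regular (fun v => ((v.1 : 'rV[C]_n) 0 i ^+ m - (v.1 : 'rV[C]_n) 0 j ^+ m)^-1).
Proof.
wlog ij : i j / (i < j)%N => [hw|_].
  rewrite neq_ltn => /orP[ij|ji]; first by apply: hw => //; rewrite neq_ltn ij.
  have := hw j i ji; rewrite neq_ltn ji => /(_ isT)/(regularM (regular_cst (-1))).
  by congr regular; apply: funext => v; rewrite mulN1r -invrN opprB.
pose d (v : phase) k l := (v.1 : 'rV[C]_n) 0 k ^+ m - (v.1 : 'rV[C]_n) 0 l ^+ m.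
pose F (v : phase) := (\prod_k (v.1 : 'rV[C]_n) 0 k) *
  ((\prod_(l < n | (i < l)%N && (l != j)) d v i l) *
   \prod_(k < n | k != i) \prod_(l < n | (k < l)%N) d v k l).
have rd k l : regular (fun v => d v k l).
  by apply: regularB; apply: regularX; apply: regular_x.
apply: (@regularV_dvd _ F).
  apply: regularM; first by apply: regular_prod => k _; apply: regular_x.
  apply: regularM; apply: regular_prod => k _ //.
  exact: regular_prod.
move=> v; rewrite /disc /F -/(d v i j) [RHS]mulrCA; congr (_ * _).
by rewrite (bigD1 i) //= (bigD1 j) //= mulrA.
Qed.

Definition Vx_fun (i : 'I_n) : regfun := mk_regfun (regularVx i).

End Hreg.

Arguments regular_cst {C m' n} k.
Arguments regular_x {C m' n} i.
Arguments regular_p {C m' n} i.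
Arguments regularVx {C m' n} i.
Arguments regularVxm {C m' n i j} ij.
Arguments cst_fun {C m' n} k.
Arguments x_fun {C m' n} i.
Arguments p_fun {C m' n} i.
Arguments Vx_fun {C m' n} i.

Section Dunkl.
Variables (C : numClosedFieldType) (m' n : nat).
Local Notation m := m'.+1.
Variables (mu : C) (mu_prim : m.-primitive_root mu).
Local Notation G := (wreath m' n).
Local Notation phase := (phase C m' n).
Local Notation regfun := (regfun C m' n).

Lemma regularVdiff i j r :
  @regular C m' n
    (fun v => ((v.1 : 'rV[C]_n) 0 i - mu ^+ r * (v.1 : 'rV[C]_n) 0 j)^-1).
Proof.
have [<-|ij] := eqVneq i j.
  apply: (eq_regular (regularM (regular_cst (1 - mu ^+ r)^-1) (regularVx i))).
  by move=> v; rewrite -invfM mulrBl mul1r.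
pose X k (v : phase) := (v.1 : 'rV[C]_n) 0 k.
pose q v := \sum_(k < m) X i v ^+ (m.-1 - k) * (mu ^+ r * X j v) ^+ k.
have Emu v : X i v ^+ m - X j v ^+ m = (X i v - mu ^+ r * X j v) * q v.
  rewrite -subrXX exprMn -exprM mulnC exprM.
  by rewrite (prim_expr_order mu_prim) expr1n mul1r.
have rq : regular q.
  apply: regular_sum => k _; apply: regularM; apply: regularX; first exact: regular_x.
  by apply: regularM; [apply: regular_cst|apply: regular_x].
apply: (eq_regular (regularM rq (regularVxm ij))) => v.
have d0 : X i v ^+ m - X j v ^+ m != 0.
  wlog lij : i j ij @X {q Emu rq} / (i < j)%N => [hw|].
    have := ij; rewrite neq_ltn => /orP[lij|lji]; first exact: hw.
    by rewrite -opprB oppr_eq0; apply: hw => //; rewrite eq_sym.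
  have := hregP v.1; rewrite /disc mulf_eq0 negb_or => /andP[_].
  by move=> /prodf_neq0/(_ i isT)/prodf_neq0/(_ j lij).
have := d0; rewrite -/(X i v) -/(X j v) Emu mulf_eq0 negb_or => /andP[_ q0].
by rewrite invfM mulrCA mulfV ?mulr1.
Qed.

Definition Vdiff_fun (i j : 'I_n) (r : nat) : regfun :=
  mk_regfun (regularVdiff i j r).

(* The action of G on h = C^n and the contragredient one on h^*. *)
Definition act_h (g : G) (x : 'rV[C]_n) : 'rV[C]_n :=
  \row_i (mu ^+ wrot g i * x 0 ((wperm g)^-1%g i)).

Definition act_hd (g : G) (p : 'rV[C]_n) : 'rV[C]_n :=
  \row_i (mu ^- wrot g i * p 0 ((wperm g)^-1%g i)).

Lemma disc_neq0P (x : 'rV[C]_n) :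
  reflect ((forall i, x 0 i != 0) /\
           (forall i j, i != j -> x 0 i ^+ m != x 0 j ^+ m))
          (disc m' x != 0).
Proof.
rewrite /disc mulf_eq0 negb_or; apply: (iffP andP) => -[x0 xm]; split.
- by move=> i; move/prodf_neq0: x0 => ->.
- move=> i j; wlog ij : i j / (i < j)%N => [hw|_].
    rewrite neq_ltn => /orP[ij|ji]; first by apply: hw => //; rewrite neq_ltn ij.
    by rewrite eq_sym; apply: hw => //; rewrite neq_ltn ji.
  by rewrite -subr_eq0; move/prodf_neq0/(_ i isT)/prodf_neq0/(_ j ij): xm.
- exact/prodf_neq0.
- apply/prodf_neq0=> i _; apply/prodf_neq0=> j ij.
  by rewrite subr_eq0 xm // neq_ltn ij.
Qed.

Lemma mu_neq0 : mu != 0.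
Proof.
apply/eqP=> mu0; have := prim_expr_order mu_prim.
by rewrite mu0 expr0n /= => /esym/eqP; rewrite oner_eq0.
Qed.

Lemma mu_rotM (a b : 'I_m) : mu ^+ (a * b)%g = mu ^+ a * mu ^+ b.
Proof. by rewrite -exprD -(prim_expr_mod mu_prim (a + b)). Qed.

Fact act_hP (g : G) (x : hreg C m' n) : disc m' (act_h g x) != 0.
Proof.
have /disc_neq0P[x0 xm] := hregP x; apply/disc_neq0P; split=> [i|i j ij].
  by rewrite mxE mulf_neq0 ?expf_neq0 ?mu_neq0.
rewrite !mxE !exprMn -!exprM ![(_ * m)%N]mulnC !exprM.
rewrite (prim_expr_order mu_prim) !expr1n !mul1r xm //.
by rewrite (inj_eq perm_inj).
Qed.

Definition act_phase (g : G) (v : phase) : phase :=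
  (Hreg (act_hP g v.1), act_hd g v.2).

Lemma phaseP (u v : phase) :
  u.1 = v.1 :> 'rV[C]_n -> u.2 = v.2 -> u = v.
Proof.
case: u v => [[x xP] p] [[y yP] q] /= xy pq; rewrite pq; congr pair.
by case: _ / xy in yP *; congr Hreg; apply: bool_irrelevance.
Qed.

Lemma act_phase1 v : act_phase 1%g v = v.
Proof.
by apply: phaseP; apply/rowP=> i;
  rewrite mxE /= ffunE ?expr0 ?invr1 mul1r invg1 perm1.
Qed.

Lemma act_phaseM g h v : act_phase (g * h)%g v = act_phase g (act_phase h v).
Proof.
by apply: phaseP; apply/rowP=> i;
  rewrite !mxE /= ffunE mu_rotM ?invfM mulrA invMg permM.
Qed.

Lemma regular_act g f : @regular C m' n f -> regular (f \o act_phase g).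
Proof.
elim=> {f} [k|i|i||f h _ rf _ rh|f h _ rf _ rh] /=.
- exact: regular_cst.
- apply: (eq_regular (regularM (regular_cst (mu ^+ wrot g i))
                   (regular_x ((wperm g)^-1%g i)))).
  by move=> v; rewrite /= mxE.
- apply: (eq_regular (regularM (regular_cst (mu ^- wrot g i))
                   (regular_p ((wperm g)^-1%g i)))).
  by move=> v; rewrite /= mxE.
- pose y i (v : phase) := mu ^- wrot g i * ((v.1 : 'rV[C]_n) 0 ((wperm g)^-1%g i))^-1.
  pose d i j (v : phase) := ((v.1 : 'rV[C]_n) 0 ((wperm g)^-1%g i) ^+ m -
                  (v.1 : 'rV[C]_n) 0 ((wperm g)^-1%g j) ^+ m)^-1.
  have ry i : regular (y i).
    by apply: regularM; [apply: regular_cst|apply: regularVx].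
  have rd (i j : 'I_n) : (i < j)%N -> regular (d i j).
    by move=> ij; apply: regularVxm; rewrite (inj_eq perm_inj) neq_ltn ij.
  apply: (@eq_regular _ _ _ (fun v => (\prod_i y i v) *
    \prod_(i < n) \prod_(j < n | (i < j)%N) d i j v)).
    apply: regularM; apply: regular_prod => i _; first exact: ry.
    by apply: regular_prod => j; apply: rd.
  move=> v; rewrite /disc /= invfM -!prodfV.
  congr (_ * _); first by apply: eq_bigr => i _; rewrite /y mxE invfM.
  apply: eq_bigr => i _; rewrite -prodfV; apply: eq_bigr => j _; rewrite /d !mxE.
  rewrite !exprMn -!exprM ![(_ * m)%N]mulnC !exprM.
  by rewrite (prim_expr_order mu_prim) !expr1n !mul1r.
- exact: regularD.
- exact: regularM.
Qed.

(* (g f)(v) = f(g^-1 v) *)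
Definition reg_act (g : G) (f : regfun) : regfun :=
  mk_regfun (regular_act g^-1%g (asboolW (regfunP f))).

Lemma regfunE (f h : regfun) : f =1 h -> f = h.
Proof. by move=> fh; apply: val_inj; apply: funext. Qed.

Fact reg_act_nmod g : nmod_morphism (reg_act g).
Proof. by split=> [|f h]; apply: regfunE. Qed.

Fact reg_act_monoid g : monoid_morphism (reg_act g).
Proof. by split=> [|f h]; apply: regfunE. Qed.

HB.instance Definition _ g :=
  GRing.isNmodMorphism.Build regfun regfun (reg_act g) (reg_act_nmod g).
HB.instance Definition _ g :=
  GRing.isMonoidMorphism.Build regfun regfun (reg_act g) (reg_act_monoid g).

Fact reg_act1 f : reg_act 1%g f = f.
Proof. by apply: regfunE => v /=; rewrite invg1 act_phase1. Qed.

Fact reg_actM g h f : reg_act (g * h)%g f = reg_act g (reg_act h f).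
Proof. by apply: regfunE => v /=; rewrite invMg act_phaseM. Qed.

Definition G_action : ring_action G regfun :=
  @RingAction G regfun (fun g => reg_act g) reg_act1 reg_actM.

Lemma mu_rotV (a : 'I_m) : mu ^+ (a^-1)%g = mu ^- a.
Proof.
apply: (mulIf (expf_neq0 a mu_neq0)).
by rewrite -mu_rotM mulVg mulVf ?expf_neq0 ?mu_neq0.
Qed.

Lemma mu_rotZp1 : mu ^+ (Zp1 : 'I_m) = mu.
Proof. by rewrite /= (prim_expr_mod mu_prim). Qed.

(* s_i(x_i) = mu^-1 x_i, s_i(p_i) = mu p_i, sigma(x_i) = x_(sigma i) *)
Lemma G_action_wgen_x i :
  G_action (wgen m' i) (x_fun i) = cst_fun mu^-1 * x_fun i.
Proof.
apply: regfunE => v; rewrite [LHS]/= !mxE /= !ffunE /= !invg1 !perm1 eqxx.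
by rewrite mu_rotV mu_rotZp1.
Qed.

Lemma G_action_wgen_p i :
  G_action (wgen m' i) (p_fun i) = cst_fun mu * p_fun i.
Proof.
apply: regfunE => v; rewrite [LHS]/= !mxE /= !ffunE /= !invg1 !perm1 eqxx.
by rewrite mu_rotV mu_rotZp1 invrK.
Qed.

Lemma G_action_perm_x (s : 'S_n) i :
  G_action (Wreath s [ffun => 1%g]) (x_fun i) = x_fun (s i).
Proof.
by apply: regfunE => v; rewrite [LHS]/= !mxE /= !ffunE invg1 mul1r invgK.
Qed.

Lemma G_action_perm_p (s : 'S_n) i :
  G_action (Wreath s [ffun => 1%g]) (p_fun i) = p_fun (s i).
Proof.
apply: regfunE => v; rewrite [LHS]/= !mxE /= !ffunE invg1.
by rewrite invr1 mul1r invgK.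
Qed.

(* C[hreg x h^*] * G *)
Local Notation CG := (crossed G_action).
Local Notation "k %:cst" := (cst_fun k) (at level 2, format "k %:cst").

Definition epsilon_at (l : nat) (i : 'I_n) : CG :=
  (m%:R^-1)%:cst *:
    \sum_(r < m) (mu ^- (l * r))%:cst *: [gr G_action : wgen m' i ^+ r].

Definition dunkl (c00 : C) (kappa : 'I_m -> C) (i : 'I_n) : CG :=
  p_fun i *: (1 : CG)
  - c00%:cst *: \sum_(j < n | j != i) \sum_(r < m)
      Vdiff_fun i j r *:
        [gr G_action : wgen m' i ^+ r * wtransp m' i j * wgen m' i ^- r]
  - Vx_fun i *: \sum_(l < m) (m%:R * kappa l)%:cst *: epsilon_at l i.

Definition symmetrizer : CG :=
  (#|{: G}|%:R^-1)%:cst *: \sum_(g : G) [gr G_action : g].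

Definition cm_hamiltonian (c00 : C) (kappa : 'I_m -> C) (j : nat) : regfun :=
  crossed_sum
    (symmetrizer * (\sum_(i < n) dunkl c00 kappa i ^+ (j * m)) * symmetrizer).

End Dunkl.

Section Quiver.
Variables (C : numClosedFieldType) (m' n : nat).
Local Notation m := m'.+1.

(* The idempotents of the group algebra C Gamma. *)
Definition epsilon (mu : C) (l : nat) : group_algebra C 'I_m :=
  m%:R^-1 *: \sum_(r < m) mu ^- (l * r) *:
    [gr trivial_action 'I_m C : Zp1 ^+ r].

Definition cm_a (lam : 'I_m -> C) : C :=
  - \sum_(r < m) (m - r)%:R / m%:R * lam r.

Definition Y_block (lam : 'I_m -> C) (nu : hreg C m' n) (p : 'rV[C]_n)
    (i : 'I_m) : 'M[C]_n :=
  \matrix_(j, k)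
    if j == k
    then p 0 j + (nu 0 j)^-1 * (cm_a lam + \sum_(r < m | (r <= i)%N) lam r)
    else (\sum_r lam r) * (nu 0 j ^+ i * nu 0 k ^+ (m - i - 1)
                            / (nu 0 j ^+ m - nu 0 k ^+ m)).

(* Acting on columns, the block (i, k) maps V_k to V_i. *)
Definition Y_mx (lam : 'I_m -> C) (nu : hreg C m' n) (p : 'rV[C]_n) :
    'M[C]_(\sum_(i < m) n) :=
  \mxblock_(i < m, k < m) if k == ordS i then Y_block lam nu p i else 0.

End Quiver.

(* Main.v *)
(** On functions f of x_i alone, among the points of a single G-orbit
    through (nu, p), the Dunkl operator D_i acts by an mn x mn matrix.  After a
    Fourier transform over Z/m this matrix is Y, so L_j(nu, p) is the sum of the
    entries of the block Z^j of Y^(jm), where Z = Y_0 Y_1 ... Y_(m-1).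

    The sum of the entries is a trace because of the moment map equation: if X
    multiplies by diag(nu) from V_i to V_(i+1), then [X, Y] is -lambda_i on V_i,
    plus |lambda| times the all-ones matrix on V_0.  As [X, Y] Y^(jm) is
    traceless, |lambda| (sum of the entries of Z^j) = |lambda| tr Z^j.  If
    |lambda| = 0, the blocks Y_i are diagonal and nothing is to be proved. *)

Require Import Defs.
From mathcomp Require Import all_boot all_order all_fingroup all_algebra.
From mathcomp Require Import reals complex.
From mathcomp Require Import ring.

Set Implicit Arguments.
Unset Strict Implicit.
Unset Printing Implicit Defensive.

Import Order.TTheory GRing.Theory Num.Theory.
Local Open Scope ring_scope.

(** * Products of consecutive matrices in a periodic sequence *)

Section PathProduct.
Variables (R : comPzRingType) (n : nat).
Implicit Type Z : nat -> 'M[R]_n.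

Fixpoint path_prod Z (s N : nat) : 'M[R]_n :=
  if N is N'.+1 then Z s *m path_prod Z s.+1 N' else 1%:M.

Lemma path_prodSr Z s N :
  path_prod Z s N.+1 = path_prod Z s N *m Z (s + N)%N.
Proof.
elim: N s => [|N IHN] s; first by rewrite /= addn0 mul1mx mulmx1.
by rewrite -[LHS]/(Z s *m path_prod Z s.+1 N.+1) IHN -addSnnS mulmxA.
Qed.

Lemma path_prod_diag Z s N : (forall t, is_diag_mx (Z t)) ->
  is_diag_mx (path_prod Z s N).
Proof.
move=> dZ; elim: N s => [|N IHN] s /=; first exact: scalar_mx_is_diag.
have /diag_mxP[d ->] := dZ s; have /diag_mxP[d' ->] := IHN s.+1.
by rewrite mulmx_diag diag_mx_is_diag.
Qed.

Variables (m : nat) (Z : nat -> 'M[R]_n).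
Hypothesis Z_per : forall s, Z (s + m)%N = Z s.

Lemma Z_perM s j : Z (s + j * m)%N = Z s.
Proof. by elim: j => [|j IHj]; rewrite ?addn0 // mulSn addnCA addnC Z_per. Qed.

Lemma path_prod_perM s j N : path_prod Z (s + j * m) N = path_prod Z s N.
Proof. by elim: N s => //= N IHN s; rewrite Z_perM -addSn IHN. Qed.

Lemma path_prod_mod s N : path_prod Z (s %% m) N = path_prod Z s N.
Proof. by rewrite [in RHS](divn_eq s m) addnC path_prod_perM. Qed.

(** A closed path may start anywhere: cyclicity of the trace moves the first factor to the end,
    where periodicity makes it the next factor of the path starting at s + 1. *)
Lemma mxtrace_path_prod j s :
  \tr (path_prod Z s (j * m)) = \tr (path_prod Z 0 (j * m)).
Proof.
elim: s => // s <-; have := Z_perM s j.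
case: (j * m)%N => [|N] // ZsN.
by rewrite path_prodSr addSnnS ZsN mxtrace_mulC.
Qed.

(** This is tr([X, Y] Y^(jm)) = 0, split over the vertices. Cyclicity of the trace turns the s-th
    term into [T s - T s.+1]; the sum telescopes, and [T] has period m. *)
Lemma mxtrace_path_commutator (X : 'M[R]_n) j :
  \sum_(s < m) \tr ((X *m Z s - Z s.+1 *m X) *m path_prod Z s.+1 (j * m)) = 0.
Proof.
pose T s := \tr (X *m path_prod Z s (j * m).+1).
have TE s : \tr ((X *m Z s - Z s.+1 *m X) *m path_prod Z s.+1 (j * m))
    = T s - T s.+1.
  rewrite mulmxBl raddfB /= -!mulmxA; congr (_ - _).
  by rewrite mxtrace_mulC -mulmxA /T path_prodSr Z_perM.
under eq_bigr do rewrite TE -opprB.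
rewrite sumrN -(big_mkord xpredT (fun s => T s.+1 - T s)) telescope_sumr //.
have := path_prod_perM 0 1 (j * m).+1; rewrite add0n mul1n /T => ->.
by rewrite subrr oppr0.
Qed.

End PathProduct.

(** * Powers of the block matrix of a cyclic quiver *)

Section CyclicQuiver.
Variables (R : comPzRingType) (m' n : nat).
Local Notation m := m'.+1.

Lemma inZp_per s : inZp (s + m) = inZp s :> 'I_m.
Proof. by apply: val_inj; rewrite /= modnDr. Qed.

Lemma cyclic_mxX (B : 'I_m -> 'M[R]_n) N :
  (\mxblock_(i < m, k < m) if k == ordS i then B i else 0) ^+ N =
  \mxblock_(i < m, k < m)
    if k == inZp (i + N) then path_prod (B \o inZp) i N else 0.
Proof.
elim: N => [|N IHN].
  rewrite expr0 -[LHS](@mxdiagZ R m (fun=> n) 1); apply: eq_mxblock => i k.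
  rewrite conform_mx_id addn0 eq_sym; congr (if k == _ then _ else _).
  by apply: val_inj; rewrite /= modn_small.
rewrite exprS IHN -[LHS]/(_ *m _) mul_mxblock; apply: eq_mxblock => i k.
rewrite (bigD1 (ordS i)) //= eqxx big1 => [|l /negPf ->]; last by rewrite mul0mx.
rewrite addr0 (path_prod_mod (m := m)) => [|s]; last by rewrite /= inZp_per.
rewrite valZpK; have -> : inZp (i.+1 %% m + N) = inZp (i + N.+1) :> 'I_m.
  by apply: val_inj; rewrite /= modnDml addSnnS.
by case: ifP => _ //; rewrite mulmx0.
Qed.

(** The m diagonal blocks are the same closed path started at different vertices, so their traces
    agree. *)
Lemma mxtrace_cyclic_mxX (B : 'I_m -> 'M[R]_n) j :
  \tr ((\mxblock_(i < m, k < m) if k == ordS i then B i else 0) ^+ (j * m)) =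
  m%:R * \tr (path_prod (B \o inZp) 0 (j * m)).
Proof.
have Bper s : (B \o inZp) (s + m)%N = (B \o inZp) s by rewrite /= inZp_per.
rewrite cyclic_mxX mxtrace_mxblock -[in m%:R](card_ord m) mulr_natl -sumr_const.
apply: eq_bigr => i _.
have -> : inZp (i + j * m) = i :> 'I_m.
  by apply: val_inj; rewrite /= addnC modnMDl modn_small.
by rewrite eqxx mxtrace_path_prod.
Qed.

End CyclicQuiver.

(** * The blocks Y_i and the moment map equation *)

Section CalogeroMoserBlocks.
Variables (C : numClosedFieldType) (m' n : nat).
Local Notation m := m'.+1.
Variables (lam : 'I_m -> C) (nu : hreg C m' n) (p : 'rV[C]_n).
Local Notation Y := (Y_block lam nu p).
Local Notation Z := (Y \o inZp).

Lemma nu_neq0 i : (nu : 'rV[C]_n) 0 i != 0.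
Proof. by have /disc_neq0P[] := hregP nu. Qed.

Lemma subr_nuX_neq0 i j : i != j ->
  (nu : 'rV[C]_n) 0 i ^+ m - (nu : 'rV[C]_n) 0 j ^+ m != 0.
Proof. by have /disc_neq0P[_ nuX] := hregP nu => /nuX; rewrite subr_eq0. Qed.

(** Off the diagonal the two products cancel, except when the index wraps to 0: there the difference
    has numerator nu_j^m - nu_k^m and leaves |lambda|. On the diagonal p and a cancel, and the
    partial sums of [lam] differ by one term, or by |lambda| - lambda_0 at the wrap. *)
Lemma Y_block_commutator s :
  diag_mx nu *m Z s - Z s.+1 *m diag_mx nu =
  (if (m %| s.+1)%N then const_mx (\sum_r lam r) else 0)
  - (lam (inZp s.+1))%:M.
Proof.
have s1E : (s.+1 %% m)%N = ((s %% m).+1 %% m)%N by rewrite -addn1 -modnDml addn1.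
have [Zs Zs1] : inZp s = inZp (s %% m) :> 'I_m /\ inZp s.+1 = inZp (s %% m).+1 :> 'I_m.
  by split; apply: val_inj; rewrite /= ?modn_mod.
rewrite /dvdn s1E /= Zs Zs1; have := ltn_pmod s (ltn0Sn m').
(* Now i < m, and [im] separates the wrap i = m - 1 from the case where i + 1 is still a vertex. *)
move: (s %% m)%N => {s s1E Zs Zs1} i; rewrite ltnS leq_eqVlt => im.
apply/matrixP => j k; rewrite mul_diag_mx mul_mx_diag !mxE /=.
have xj0 := nu_neq0 j; case: eqVneq => [<-|/subr_nuX_neq0 jk0]; last first.
  rewrite mulr0n subr0; case/orP: im => [/eqP ->|im].
    rewrite modnn mxE modn_small // subSnn subn0 !subn1 /=.
    by move: jk0; rewrite !exprS => jk0; field.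
  rewrite (modn_small (ltnW im : (i < m)%N)) (modn_small (im : (i.+1 < m)%N)) mxE.
  have -> : (m - i - 1 = (m - i.+1 - 1).+1)%N by rewrite -!subnDA !addn1 subnSK.
  by move: jk0; rewrite !exprS => jk0; field.
rewrite mulr1n; case/orP: im => [/eqP ->|im].
  rewrite modnn !mxE modn_small //.
  rewrite (eq_bigl xpredT) => [|r]; last by rewrite -ltnS ltn_ord.
  rewrite [\sum_(r < _ | (r <= 0)%N) _](big_pred1 0) => [|r]; last first.
    by rewrite leqn0 -[RHS]val_eqE.
  have -> : inZp m = 0 :> 'I_m by apply: val_inj; rewrite /= modnn.
  by field.
rewrite (modn_small (ltnW im : (i < m)%N)) (modn_small (im : (i.+1 < m)%N)) mxE.
rewrite [\sum_(r < m | (r <= i.+1)%N) _](bigD1 (inZp i.+1)) /=; last first.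
  by rewrite modn_small.
rewrite [\sum_(r < m | (r <= i.+1)%N && _) _](eq_bigl (fun r : 'I_m => (r <= i)%N)).
  by field.
move=> r; rewrite -val_eqE /= modn_small //.
by rewrite andbC -ltn_neqAle ltnS.
Qed.

Lemma mxtrace_path_block j :
  \tr (path_prod Z 0 (j * m)) =
  \sum_i \sum_k path_prod Z 0 (j * m) i k.
Proof.
have Zper s : Z (s + m)%N = Z s by rewrite /= inZp_per.
have := mxtrace_path_commutator Zper (diag_mx nu) j.
have path0 t : (m %| t)%N -> path_prod Z t (j * m) = path_prod Z 0 (j * m).
  by move=> /dvdnP[q ->]; rewrite -(path_prod_perM Zper 0 q) add0n.
set N := (j * m)%N; rewrite -/N in path0 *.
set tau := \tr _; set sig := \sum_i _ => comm0.
have commE s : \tr ((diag_mx nu *m Z s - Z s.+1 *m diag_mx nu) *m path_prod Z s.+1 N)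
    = (if (m %| s.+1)%N then (\sum_r lam r) * sig else 0) - lam (inZp s.+1) * tau.
  rewrite Y_block_commutator mulmxBl raddfB /= mul_scalar_mx mxtraceZ.
  rewrite (mxtrace_path_prod Zper) -/N -/tau; congr (_ - _).
  case: ifP => [/path0 ->|_]; last by rewrite mul0mx mxtrace0.
  (* The trace of a constant matrix times a path is the constant times the sum of all entries of the
     path. *)
  rewrite /mxtrace /sig exchange_big mulr_sumr; apply: eq_bigr => k _ /=.
  by rewrite mxE mulr_sumr; apply: eq_bigr => l _; rewrite mxE.
have lam_tau : (\sum_r lam r) * sig = (\sum_r lam r) * tau.
  apply: subr0_eq; move: comm0; under eq_bigr do rewrite commE.
  have -> : \sum_r lam r = \sum_(s < m) lam (inZp s.+1).
    rewrite (reindex_inj (@ordS_inj m)); apply: eq_bigr => s _.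
    by congr (lam _); apply: val_inj.
  (* Among s < m, only the last index has m dividing s + 1, so [sig] occurs once. *)
  rewrite sumrB -mulr_suml big_ord_recr /=.
  rewrite dvdnn big1 ?add0r // => s _.
  by rewrite gtnNdvd // ltnS.
have [lam0|lam_neq0] := eqVneq (\sum_r lam r) 0; last first.
  by apply/esym/(mulfI lam_neq0).
have dZ s : is_diag_mx (Z s).
  by apply/is_diag_mxP => k l kl; rewrite mxE -val_eqE (negPf kl) lam0 mul0r.
have /is_diag_mxP dP := path_prod_diag 0 N dZ.
apply: eq_bigr => k _; rewrite (bigD1 k) //= big1 ?addr0 // => l lk.
by rewrite dP // eq_sym.
Qed.

End CalogeroMoserBlocks.

(** * Sums over the m-th roots of unity *)

Lemma dvdn_addE m k l : (0 < l <= m)%N -> (k < m)%N ->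
  (m %| k + l)%N = (k == m - l)%N.
Proof.
move=> /andP[l_gt0 lm] km; apply/idP/eqP => [|->]; last by rewrite subnK.
move=> /dvdnP[[|[|q]] klE].
- by move/eqP: klE; rewrite addn_eq0 [l == _]gtn_eqF ?andbF.
- by rewrite -[m]mul1n -klE addnK.
- have : (k + l < m + m)%N by rewrite -addSn leq_add.
  by rewrite klE !mulSn addnA ltnNge leq_addr.
Qed.

Section RootsOfUnity.
Variables (F : fieldType) (m' : nat).
Local Notation m := m'.+1.
Variables (mu : F) (mu_prim : m.-primitive_root mu).

Lemma sum_prim_root_expr t :
  \sum_(r < m) mu ^+ (r * t) = if (m %| t)%N then m%:R else 0.
Proof.
rewrite (prim_order_dvd mu_prim); under eq_bigr do rewrite mulnC exprM.
case: eqP => [->|/eqP mut].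
  by under eq_bigr do rewrite expr1n; rewrite sumr_const card_ord.
apply: (mulfI (x := mu ^+ t - 1)); first by rewrite subr_eq0.
by rewrite mulr0 -subrX1 exprAC (prim_expr_order mu_prim) expr1n subrr.
Qed.

(** Since (mu^r y)^m = y^m, each 1 / (x - mu^r y) is a geometric sum over k divided by x^m - y^m.
    Summing over r leaves only the k with m dividing k + t + 1, namely k = m - t - 1. This is how
    the off-diagonal entries of Y_t arise from reflections. *)
Lemma sum_prim_root_fraction (x y : F) t : (t < m)%N -> x ^+ m != y ^+ m ->
  \sum_(r < m) (mu ^+ r) ^+ t.+1 / (x - mu ^+ r * y)
  = m%:R * (x ^+ t * y ^+ (m - t - 1) / (x ^+ m - y ^+ m)).
Proof.
move=> tm; rewrite -subr_eq0 => xy0.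
have fracE (r : 'I_m) : (mu ^+ r) ^+ t.+1 / (x - mu ^+ r * y)
  = \sum_(k < m) (x ^+ (m.-1 - k) * y ^+ k / (x ^+ m - y ^+ m)) * mu ^+ (r * (k + t.+1)).
  have xyE : x ^+ m - y ^+ m =
      (x - mu ^+ r * y) * \sum_(k < m) x ^+ (m.-1 - k) * (mu ^+ r * y) ^+ k.
    by rewrite -subrXX exprMn exprAC (prim_expr_order mu_prim) expr1n mul1r.
  move: (xy0); rewrite {1}xyE mulf_eq0 negb_or => /andP[d0 s0].
  apply: (canLR (mulfK d0)); rewrite [RHS]mulrC.
  transitivity ((mu ^+ r) ^+ t.+1 / (x ^+ m - y ^+ m) * (x ^+ m - y ^+ m)).
    by rewrite mulfVK.
  rewrite {2}xyE mulrCA; congr (_ * _); rewrite mulr_sumr; apply: eq_bigr => k _.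
  by rewrite exprMn -!exprM mulnDr exprD; ring.
under eq_bigr do rewrite fracE.
rewrite exchange_big /=; under eq_bigr do rewrite -mulr_sumr sum_prim_root_expr.
have k0m : (m - t - 1 < m)%N by rewrite -subnDA addn1 subSS ltnS leq_subr.
rewrite (bigD1 (Ordinal k0m)) //= big1 ?addr0 => [|k].
  have -> : (m' - (m - t - 1) = t)%N by rewrite -subnDA addn1 subSS subKn.
  have -> : (m - t - 1 + t.+1 = m)%N by rewrite -subnDA addn1 subnK.
  by rewrite dvdnn mulrC.
by rewrite -val_eqE /= -subnDA addn1 dvdn_addE // => /negPf ->; rewrite mulr0.
Qed.

Lemma primitive_rootV : m.-primitive_root mu^-1.
Proof.
apply/andP; split=> //; apply/forallP=> i.
have /andP[_ /forallP/(_ i)] := mu_prim.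
by rewrite !unity_rootE exprVn invr_eq1.
Qed.

End RootsOfUnity.

Section CrossedCoefficients.
Variables (gT : finGroupType) (A : pzRingType) (to : ring_action gT A).

Lemma crossed_coef_sum (I : Type) (r : seq I) (P : pred I)
    (F : I -> crossed to) g :
  (\sum_(i <- r | P i) F i) g = \sum_(i <- r | P i) F i g.
Proof. by apply: (big_morph (fun b : crossed to => b g)) => [a b|]; rewrite ffunE. Qed.

End CrossedCoefficients.

(** * Relations between the parameters c, lambda and kappa *)

Section DeformationConstants.
Variables (C : numClosedFieldType) (m' : nat).
Local Notation m := m'.+1.
Variables (mu : C) (mu_prim : m.-primitive_root mu) (c lam kappa : 'I_m -> C).
Hypotheses
    (lam_0 : lam ord0 =
       - (m%:R * c ord0) + \sum_(l < m | l != ord0) c l)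
    (lam_i : forall i : 'I_m, i != ord0 ->
       lam i = \sum_(l < m | l != ord0) c l * mu ^- (i * l))
    (kappa_eq :
       \sum_(r < m | r != ord0)
          c r *: [gr trivial_action 'I_m C : Zp1 ^+ r]
       = \sum_(l < m)
          (m%:R * (kappa l - kappa (ord_pred l))) *: epsilon m' mu l)
    (kappa_last : kappa ord_max =
       \sum_(r < m | r != ord0) (m - r)%:R / m%:R ^+ 2 * lam r).

(** Each c_l with l nonzero is multiplied by the sum of mu^(-il) over all i, which vanishes. *)
Lemma sum_lam : \sum_r lam r = - (m%:R * c ord0).
Proof.
rewrite (bigD1 ord0) //= lam_0 -addrA.
under [X in _ + (_ + X)]eq_bigr => i i0 do rewrite lam_i //.
rewrite exchange_big -big_split /= big1 ?addr0 // => l l0.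
rewrite -{1}[c l]mulr1 -mulr_sumr -mulrDr.
have -> : 1 + \sum_(i < m | i != ord0) mu ^- (i * l) =
    \sum_(i < m) (mu^-1) ^+ (i * l).
  rewrite [RHS](bigD1 ord0) //= expr0; congr (_ + _).
  by apply: eq_bigr => i _; rewrite exprVn.
by rewrite (sum_prim_root_expr (primitive_rootV mu_prim)) gtnNdvd ?mulr0 // lt0n.
Qed.

(** Both sides are the coefficient of s^k in [kappa_eq]. *)
Lemma coef_kappa (k : 'I_m) :
  \sum_l (kappa l - kappa (ord_pred l)) * mu ^- (l * k) =
  if k == ord0 then 0 else c k.
Proof.
transitivity ((\sum_(r < m | r != ord0)
    c r *: [gr trivial_action 'I_m C : Zp1 ^+ r]) k); last first.
  rewrite crossed_coef_sum; under eq_bigr do rewrite Zp1_expgz !ffunE.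
  case: eqVneq => [->|k0].
    by rewrite big1 // => r /negPf r0; rewrite eq_sym r0 mulr0.
  rewrite (bigD1 k) //= eqxx mulr1 big1 ?addr0 // => r /andP[_ /negPf rk].
  by rewrite eq_sym rk mulr0.
rewrite kappa_eq crossed_coef_sum; apply: eq_bigr => l _.
rewrite /epsilon ffunE ffunE crossed_coef_sum.
under [in RHS]eq_bigr => r _ do rewrite Zp1_expgz !ffunE.
rewrite (bigD1 k) //= big1 => [|r /negPf rk]; last by rewrite eq_sym rk mulr0.
by rewrite eqxx mulr1 addr0 mulrCA mulrA mulKf ?pnatr_eq0.
Qed.

(** Fourier inversion: by [coef_kappa] the c_l are the transform of the differences of kappa, and
    lambda_i transforms them once more. Only the index k = m - i survives, which is
    [ordS (rev_ord i)] because i is nonzero. *)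
Lemma lam_kappa (i : 'I_m) : i != ord0 ->
  lam i = m%:R * (kappa (ordS (rev_ord i)) - kappa (rev_ord i)).
Proof.
move=> i0; have i_gt0 : (0 < i)%N by rewrite lt0n.
pose d l := kappa l - kappa (ord_pred l).
transitivity (\sum_(l < m) \sum_k d k * mu ^- (k * l) * mu ^- (i * l)).
  rewrite lam_i // [RHS](bigD1 ord0) //= -mulr_suml (coef_kappa ord0) mul0r add0r.
  by apply: eq_bigr => l l0; rewrite -mulr_suml (coef_kappa l) (negPf l0).
rewrite exchange_big /=; under eq_bigr => k _.
  under eq_bigr do rewrite -mulrA -!exprVn -exprD -mulnDl mulnC.
  rewrite -mulr_sumr (sum_prim_root_expr (primitive_rootV mu_prim)).
  over.
have k0E : ordS (rev_ord i) = (m - i)%N :> nat.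
  by rewrite /= -subSn // subSS modn_small // ltn_subrL i_gt0.
rewrite (bigD1 (ordS (rev_ord i))) // big1 => [|k /= kk0].
  by rewrite k0E subnK ?dvdnn // 1?ltnW // /d ordSK [LHS]addr0 mulrC.
have im : (0 < i <= m)%N by rewrite i_gt0 ltnW.
by rewrite (dvdn_addE im) // -k0E [_ == _ :> nat](negPf kk0) mulr0.
Qed.

(** This matches the diagonal of Y_i with the rotation term of the Dunkl operators. Induction on i:
    each new lambda is a difference of consecutive kappas by [lam_kappa]. *)
Lemma cm_a_kappa (i : 'I_m) :
  cm_a lam + \sum_(r < m | (r <= i)%N) lam r = - (m%:R * kappa (rev_ord i)).
Proof.
have m0 : m%:R != 0 :> C by rewrite pnatr_eq0.
case: i => i; elim: i => [|i IHi] im.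
  rewrite (big_pred1 ord0) => [|r]; last by rewrite leqn0 -[RHS]val_eqE.
  have -> : rev_ord (Ordinal im) = ord_max by apply: val_inj; rewrite /= subn1.
  (* The r = 0 term of [cm_a] cancels lambda_0; the rest is -m kappa_(m-1) by the normalisation
     [kappa_last]. *)
  rewrite kappa_last /cm_a (bigD1 ord0) //= subn0 mulfV // mul1r opprD addrAC addNr add0r.
  rewrite mulr_sumr; congr (- _); apply: eq_bigr => r _.
  by move: (m%:R : C) m0 ((m - r)%:R : C) => M M0 a; field.
have im' := ltnW im; have := IHi im'.
rewrite [in RHS](_ : rev_ord (Ordinal im') = ordS (rev_ord (Ordinal im))); last first.
  by apply: val_inj; rewrite /= subnSK // modn_small // ltn_subrL.
rewrite [in X in _ -> X](bigD1 (Ordinal im)) //=.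
rewrite [in X in _ -> X](eq_bigl (fun r : 'I_m => (r <= i)%N)) => [|r]; last first.
  by rewrite andbC -[_ != _]/(val r != i.+1) -ltn_neqAle ltnS.
move=> IH; rewrite addrCA IH lam_kappa //.
by ring.
Qed.

End DeformationConstants.

(** * The crossed product acting on functions on phase space *)

Section Evaluation.
Variables (C : numClosedFieldType) (m' n : nat).
Local Notation m := m'.+1.
Variables (mu : C) (mu_prim : m.-primitive_root mu).
Local Notation G := (wreath m' n).
Local Notation phase := (phase C m' n).
Local Notation act := (G_action n mu_prim).
Local Notation CG := (crossed act).
Local Notation move_by := (act_phase mu_prim).
Implicit Types (g h : G) (b : CG) (f : phase -> C) (v : phase).

(** The value at v of b applied to f, with (g f)(v) = f(g^-1 v). Here f is an arbitrary function, so
    it can be known on a single orbit only. *)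
Definition crossed_ev b f v : C := \sum_(g : G) b g v * f (move_by g^-1%g v).

Lemma regfun_sumE (I : Type) (r : seq I) (P : pred I) (F : I -> regfun C m' n) v :
  (\sum_(k <- r | P k) F k) v = \sum_(k <- r | P k) F k v.
Proof. exact: (big_morph (fun f : regfun C m' n => f v)). Qed.

(* So the map m of the paper sends b to b applied to the constant 1. *)
Lemma crossed_sum_ev b v : crossed_sum b v = crossed_ev b (fun=> 1) v.
Proof.
by rewrite /crossed_sum regfun_sumE; apply: eq_bigr => g _; rewrite mulr1.
Qed.

(** As [crossed_sum b] is b applied to 1, this is compatibility of the action with products; it lets
    powers of D_i be computed by iteration. *)
Lemma crossed_sum_mul a b v :
  crossed_sum (a * b) v = crossed_ev a (fun u => crossed_sum b u) v.
Proof.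
rewrite /crossed_sum regfun_sumE.
transitivity (\sum_g \sum_h a h v * b (h^-1 * g)%g (move_by h^-1%g v)).
  by apply: eq_bigr => g _; rewrite ffunE regfun_sumE.
rewrite exchange_big; apply: eq_bigr => h _ /=.
rewrite regfun_sumE mulr_sumr (reindex_inj (mulgI h)) /=.
by apply: eq_bigr => g _; rewrite mulKg.
Qed.

Lemma eq_crossed_ev b f f' v : f =1 f' -> crossed_ev b f v = crossed_ev b f' v.
Proof. by move=> ff'; apply: eq_bigr => g _; rewrite ff'. Qed.

Lemma crossed_evB a b f v :
  crossed_ev (a - b) f v = crossed_ev a f v - crossed_ev b f v.
Proof.
by rewrite -sumrB; apply: eq_bigr => g _; rewrite !ffunE mulrBl.
Qed.

Lemma crossed_ev_sum (I : Type) (r : seq I) (P : pred I) (F : I -> CG) f v :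
  crossed_ev (\sum_(k <- r | P k) F k) f v =
  \sum_(k <- r | P k) crossed_ev (F k) f v.
Proof.
rewrite exchange_big; apply: eq_bigr => g _ /=.
by rewrite crossed_coef_sum regfun_sumE mulr_suml.
Qed.

Lemma crossed_evZ (k : regfun C m' n) b f v :
  crossed_ev (k *: b) f v = k v * crossed_ev b f v.
Proof.
by rewrite mulr_sumr; apply: eq_bigr => g _; rewrite ffunE mulrA.
Qed.

Lemma crossed_ev_gr g f v :
  crossed_ev [gr act : g] f v = f (move_by g^-1%g v).
Proof.
rewrite /crossed_ev (bigD1 g) //= ffunE eqxx big1 => [|h /negPf hg].
  by rewrite addr0 mul1r.
by rewrite ffunE hg mul0r.
Qed.

Lemma crossed_ev1 f v : crossed_ev 1 f v = f v.
Proof. by rewrite (crossed_ev_gr 1%g) invg1 act_phase1. Qed.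

Lemma crossed_sum_symmetrizer v : crossed_sum (symmetrizer n mu_prim) v = 1.
Proof.
rewrite crossed_sum_ev crossed_evZ crossed_ev_sum.
under eq_bigr do rewrite crossed_ev_gr.
rewrite sumr_const /= mulVf // pnatr_eq0 -lt0n.
by apply/card_gt0P; exists 1%g.
Qed.

(* |(g v)_i| = |v_(wcoord g i)| *)
Definition wcoord (g : G) i := (wperm g)^-1%g i.

Lemma wcoordM g h i : wcoord (g * h)%g i = wcoord h (wcoord g i).
Proof. by rewrite /wcoord /= invMg permM. Qed.

Lemma wcoordV g i : wcoord g^-1%g i = wperm g i.
Proof. by rewrite /wcoord /= invgK. Qed.

Lemma mu_wrotM g h i :
  mu ^+ wrot (g * h)%g i = mu ^+ wrot g i * mu ^+ wrot h (wcoord g i).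
Proof. by rewrite ffunE mu_rotM. Qed.

Lemma mu_wrotV g i : mu ^+ wrot g^-1%g i = mu ^- wrot g (wperm g i).
Proof. by rewrite ffunE mu_rotV. Qed.

Lemma wperm_wgenX (i : 'I_n) r : wperm (wgen m' i ^+ r)%g = 1%g :> 'S_n.
Proof. by elim: r => [|r IHr] //; rewrite expgS /= IHr mulg1. Qed.

Lemma mu_wgenX (i k : 'I_n) r :
  mu ^+ wrot (wgen m' i ^+ r)%g k = if k == i then mu ^+ r else 1.
Proof.
elim: r => [|r IHr]; first by rewrite ffunE if_same.
rewrite expgS mu_wrotM [wcoord _ k]/wcoord /= invg1 perm1 IHr ffunE.
by case: ifP => _; rewrite ?mul1r // mu_rotZp1 // exprS.
Qed.

(** Together with [reflectionV_act], this tracks the i-th coordinate under the group elements of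
    D_i, inverted because (s f)(v) = f(s^-1 v). *)
Lemma wgenV_act i r g (s := (wgen m' i ^+ r)%g) :
  wcoord (s^-1 * g)%g i = wcoord g i /\
  mu ^+ wrot (s^-1 * g)%g i = mu ^- r * mu ^+ wrot g i.
Proof.
by rewrite wcoordM mu_wrotM mu_wrotV wcoordV wperm_wgenX perm1 mu_wgenX eqxx.
Qed.

Lemma reflectionV_act i j r g : j != i ->
  let s := (wgen m' i ^+ r * wtransp m' i j * wgen m' i ^- r)%g in
  wcoord (s^-1 * g)%g i = wcoord g j /\
  mu ^+ wrot (s^-1 * g)%g i = mu ^+ r * mu ^+ wrot g j.
Proof.
move=> ji s.
have sE : wperm s = tperm i j by rewrite /s /= wperm_wgenX invg1 mul1g mulg1.
rewrite wcoordM mu_wrotM mu_wrotV wcoordV sE tpermL; split=> //; congr (_ * _).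
rewrite /s !mu_wrotM mu_wgenX (negPf ji) mul1r mu_wrotV !wcoordM /wcoord wperm_wgenX.
by rewrite /= invg1 !perm1 tpermV tpermR mu_wgenX eqxx ffunE expr0 mul1r invrK.
Qed.

Lemma expr_mu_modn a t : (mu ^+ a) ^+ (t %% m) = (mu ^+ a) ^+ t.
Proof. by apply: expr_mod; rewrite exprAC (prim_expr_order mu_prim) expr1n. Qed.

(** * Dunkl operators on the orbit of (nu, p) *)

Variables (c lam kappa : 'I_m -> C).
Hypotheses (lam_c00 : \sum_r lam r = - (m%:R * c ord0))
  (lam_sum_kappa : forall i : 'I_m,
     cm_a lam + \sum_(r < m | (r <= i)%N) lam r = - (m%:R * kappa (rev_ord i))).
Variables (nu : hreg C m' n) (p : 'rV[C]_n).
Local Notation Y := (Y_block lam nu p).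
Local Notation D := (dunkl mu_prim (c ord0) kappa).
Local Notation v0 := ((nu, p) : phase).

(* f has degree t + 1 for the rotation of the i-th coordinate, so that on the
   orbit it is a vector of V_(t+1). *)
Lemma dunkl_orbit (t : 'I_m) f (phi : 'cV[C]_n) i g :
  (forall h, f (move_by h v0) =
     (mu ^+ wrot h i) ^+ t.+1 * phi (wcoord h i) 0) ->
  crossed_ev (D i) f (move_by g v0) =
  (mu ^+ wrot g i) ^+ t * (Y t *m phi) (wcoord g i) 0.
Proof.
move=> fE; rewrite /dunkl !crossed_evB !crossed_evZ crossed_ev1 !crossed_ev_sum.
under eq_bigr => j ji.
  rewrite crossed_ev_sum; under eq_bigr => r _.
    rewrite crossed_evZ crossed_ev_gr -act_phaseM fE.
    have [-> ->] := reflectionV_act r g ji; over.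
  over.
under [X in _ - _ - _ * X]eq_bigr => l _.
  rewrite crossed_evZ crossed_evZ crossed_ev_sum; under eq_bigr => r _.
    rewrite crossed_evZ crossed_ev_gr -act_phaseM fE.
    have [-> ->] := wgenV_act i r g; over.
  over.
rewrite fE /= [act_hd _ _ _ _ _]mxE [act_h _ _ _ 0 i]mxE.
set w := mu ^+ wrot g i; rewrite -!/(wcoord g i); set q := wcoord g i.
have muX_neq0 r : mu ^+ r != 0 by rewrite expf_neq0 ?(mu_neq0 mu_prim).
have mu_m r : (mu ^+ r) ^+ m = 1.
  by rewrite exprAC (prim_expr_order mu_prim) expr1n.
have m0 : m%:R != 0 :> C by rewrite pnatr_eq0.
(* The reflection part: summing over r gives the off-diagonal entries of Y_t, and the permutation of
   g reindexes j. *)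
have sum_refl : \sum_(j < n | j != i) \sum_(r < m)
        (w * (nu : 'rV_n) 0 q - mu ^+ r * act_h mu g nu 0 j)^-1 *
        ((mu ^+ r * mu ^+ wrot g j) ^+ t.+1 * phi (wcoord g j) 0) =
    w ^+ t * (m%:R * \sum_(k < n | k != q)
      (nu 0 q ^+ t * nu 0 k ^+ (m - t - 1) / (nu 0 q ^+ m - nu 0 k ^+ m))
        * phi k 0).
  rewrite !mulr_sumr [RHS](reindex_inj (@perm_inj _ (wperm g)^-1%g)) /=.
  apply: eq_big => [j|j ji]; first by rewrite (inj_eq perm_inj).
  rewrite -/(wcoord g j) [act_h _ _ _ _ _]mxE -/(wcoord g j).
  set y := (nu : 'rV_n) 0 (wcoord g j); set z := mu ^+ wrot g j.
  have xy0 : (w * nu 0 q) ^+ m != (z * y) ^+ m.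
    rewrite !exprMn !mu_m !mul1r -subr_eq0 subr_nuX_neq0 //.
    by rewrite (inj_eq perm_inj) eq_sym.
  transitivity (z ^+ t.+1 * phi (wcoord g j) 0 *
      \sum_(r < m) (mu ^+ r) ^+ t.+1 / (w * nu 0 q - mu ^+ r * (z * y))).
    by rewrite mulr_sumr; apply: eq_bigr => r _; rewrite !exprMn; ring.
  rewrite (sum_prim_root_fraction mu_prim (ltn_ord t) xy0) !exprMn !mu_m !mul1r.
  (* The rotation z of the j-th coordinate drops out, leaving only the rotation w of the i-th
     one. *)
  have zm : z ^+ t.+1 * z ^+ (m - t - 1) = 1.
    by rewrite -exprD -subnDA addn1 subnKC // mu_m.
  transitivity (z ^+ t.+1 * z ^+ (m - t - 1) * (w ^+ t * (m%:R *
    (nu 0 q ^+ t * y ^+ (m - t - 1) / (nu 0 q ^+ m - y ^+ m)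
      * phi (wcoord g j) 0)))); last by rewrite zm mul1r.
  by ring.
(* The rotation part: f has degree t + 1, so epsilon_l kills it unless m divides l + t + 1, that is
   l = m - 1 - t. *)
have sum_rot : \sum_(l < m) m%:R * kappa l * (m%:R^-1 * \sum_(r < m)
         mu ^- (l * r) * ((mu ^- r * w) ^+ t.+1 * phi q 0)) =
    m%:R * kappa (rev_ord t) * (w ^+ t.+1 * phi q 0).
  have rotE (l : 'I_m) : m%:R * kappa l * (m%:R^-1 * \sum_(r < m)
         mu ^- (l * r) * ((mu ^- r * w) ^+ t.+1 * phi q 0)) =
      kappa l * (w ^+ t.+1 * phi q 0) *
      (if (m %| l + t.+1)%N then m%:R else 0).
    rewrite mulrACA mulfV // mul1r -mulrA; congr (_ * _).
    rewrite -(sum_prim_root_expr (primitive_rootV mu_prim)) mulr_sumr.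
    apply: eq_bigr => r _; rewrite mulnDr exprD [(r * l)%N]mulnC exprM !exprVn.
    by rewrite exprMn -exprM !exprVn !exprM; ring.
  under eq_bigr do rewrite rotE.
  have rev_t : (rev_ord t + t.+1 = m)%N by rewrite /= subnK.
  rewrite (bigD1 (rev_ord t)) // rev_t dvdnn big1 => [|l l_rev].
    by rewrite [LHS]addr0; ring.
  have tm : (0 < t.+1 <= m)%N by rewrite ltn_ord.
  by rewrite (dvdn_addE tm) // [_ == _](negPf l_rev) mulr0.
rewrite sum_refl sum_rot mxE [in RHS](bigD1 q) //= mxE eqxx lam_sum_kappa.
under [X in _ = _ * (_ + X)]eq_bigr => k kq.
  rewrite mxE eq_sym (negPf kq) lam_c00 -mulrA; over.
rewrite -mulr_sumr; set S := \sum_(k < n | _) _.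
have := nu_neq0 nu q; have := muX_neq0 (wrot g i); rewrite -/w !exprS.
by move=> w0 x0; field; rewrite w0 x0.
Qed.

(** Each application of D_i lowers the degree by one and multiplies by a block of Y. Starting from
    the constant 1, of degree 0, N applications reach degree t exactly when t + N is 0 mod m. *)
Lemma dunkl_expr_orbit N t i g : (m %| t + N)%N ->
  crossed_sum (D i ^+ N) (move_by g v0) =
  (mu ^+ wrot g i) ^+ t *
    (path_prod (Y \o inZp) t N *m const_mx 1 : 'cV_n) (wcoord g i) 0.
Proof.
elim: N t i g => [|N IHN] t i g tN.
  rewrite addn0 in tN; rewrite expr0 crossed_sum_ev crossed_ev1 mul1mx mxE mulr1.
  by rewrite -expr_mu_modn (eqP tN).
rewrite exprS crossed_sum_mul -expr_mu_modn /= -mulmxA -(@dunkl_orbit (inZp t)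
  (fun v => crossed_sum (D i ^+ N) v)) // => h.
(* Degrees matter only mod m, so t + 1 may replace the successor of t mod m. *)
rewrite (IHN t.+1) ?addSnnS // -expr_mu_modn -[in RHS]expr_mu_modn.
by congr (_ ^+ _ * _); rewrite /= -[in RHS]addn1 modnDml addn1.
Qed.

(** In degree t = 0 the rotation factor is 1, and summing over i absorbs the permutation, so the
    function is constant on the orbit. The right symmetrizer fixes 1 and the left one averages equal
    values. *)
Lemma cm_hamiltonian_path j :
  cm_hamiltonian n mu_prim (c ord0) kappa j v0 =
  \sum_i \sum_k path_prod (Y \o inZp) 0 (j * m) i k.
Proof.
rewrite /cm_hamiltonian -mulrA crossed_sum_mul.
set L := \sum_i _; set X := \sum_i _.
have XE g : crossed_sum (X * symmetrizer n mu_prim) (move_by g v0) = L.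
  rewrite crossed_sum_mul (eq_crossed_ev _ _ crossed_sum_symmetrizer).
  rewrite crossed_ev_sum /L [RHS](reindex_inj (@perm_inj _ (wperm g)^-1%g)) /=.
  apply: eq_bigr => i _; rewrite -crossed_sum_ev (@dunkl_expr_orbit _ 0) ?dvdn_mull //.
  by rewrite expr0 mul1r mxE; apply: eq_bigr => k _; rewrite mxE mulr1.
rewrite -[RHS]mul1r -(crossed_sum_symmetrizer v0) crossed_sum_ev /crossed_ev [RHS]mulr_suml.
by apply: eq_bigr => g _; rewrite XE mulr1.
Qed.

End Evaluation.

(* m = m'.+1 >= 1; c 0 is c_00, so that c = (c_00, c_1, ..., c_(m-1)). *)
Theorem proposition5p9 (R : realType) (m' n : nat) (n_gt0 : (0 < n)%N)
    (mu : R[i]) (mu_prim : m'.+1.-primitive_root mu)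
    (c lam kappa : 'I_m'.+1 -> R[i])
    (lam_0 : lam ord0 =
       - (m'.+1%:R * c ord0) + \sum_(l < m'.+1 | l != ord0) c l)
    (lam_i : forall i : 'I_m'.+1, i != ord0 ->
       lam i = \sum_(l < m'.+1 | l != ord0) c l * mu ^- (i * l))
    (kappa_eq :
       \sum_(r < m'.+1 | r != ord0)
          c r *: [gr trivial_action 'I_m'.+1 R[i] : Zp1 ^+ r]
       = \sum_(l < m'.+1)
          (m'.+1%:R * (kappa l - kappa (ord_pred l))) *: epsilon m' mu l)
    (kappa_last : kappa ord_max =
       \sum_(r < m'.+1 | r != ord0) (m'.+1 - r)%:R / m'.+1%:R ^+ 2 * lam r)
    (nu : hreg R[i] m' n) (p : 'rV[R[i]]_n) (j : nat) :
  m'.+1%:R^-1 * \tr (Y_mx lam nu p ^+ (j * m'.+1))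
  = cm_hamiltonian n mu_prim (c ord0) kappa j (nu, p).
Proof.
rewrite /Y_mx mxtrace_cyclic_mxX mulKf ?pnatr_eq0 // mxtrace_path_block.
rewrite (@cm_hamiltonian_path _ _ _ _ mu_prim c lam) //.
  exact: sum_lam lam_0 lam_i.
exact (cm_a_kappa mu_prim lam_i kappa_eq kappa_last).
Qed.
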